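(* For every $N$, let $\underline\gamma_N^*\in\mathbf{\Gamma}_N$ be an optimal policy for $(\mathcal{P}_N)$. If there exists $\underline\gamma^*\in\mathbf{\Gamma}$ with $J(\underline\gamma^* )<\infty$ satisfying $$\limsup_{N\to\infty}J_N(\underline\gamma_N^* )\ge J(\underline\gamma^* ),$$ then $\underline\gamma^*$ is a globally team optimal policy for $(\mathcal{P}_\infty)$.
   Context: Setting. All random variables live on a probability space $(\Omega,\mathcal{F},\mathbb{P})$; $n,m$ are positive integers. For each $i\in\mathbb{N}$, decision maker $i$ (DM$^i$) observes an $\mathbb{R}^m$-valued random variable $v^i$, which is not affected by the action of any decision maker (the team is static), and applies the action $u^i=\gamma^i(v^i)$ in the action space $\mathbb{U}^i=\mathbb{R}^n$. $\Gamma^i$ is the set of admissible policies of DM$^i$, i.e. measurable functions $\gamma^i:\mathbb{R}^m\to\mathbb{U}^i$; $\mathbf{\Gamma}_N=\prod_{i=1}^N\Gamma^i$ and $\mathbf{\Gamma}=\prod_{i\in\mathbb{N}}\Gamma^i$. $\omega_0$ is an exogenous $\Omega_0$-valued random variable and $c:\Omega_0\times\mathbb{R}^n\times\mathbb{R}^n\to\mathbb{R}_+$ is a Borel measurable cost function. Problem $(\mathcal{P}_N)$: for $\underline\gamma_N=(\gamma^1,\dots,\gamma^N)\in\mathbf{\Gamma}_N$, $J_N(\underline\gamma_N)=\frac1N\mathbb{E}^{\underline\gamma_N}\big[\sum_{i=1}^N c(\omega_0,u^i,\frac1N\sum_{p=1}^N u^p)\big]$. A policy $\underline\gamma_N^*$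 is optimal for $(\mathcal{P}_N)$ if $J_N(\underline\gamma_N^* )=\inf_{\underline\gamma_N\in\mathbf{\Gamma}_N}J_N(\underline\gamma_N)$. Problem $(\mathcal{P}_\infty)$: for $\underline\gamma=(\gamma^1,\gamma^2,\dots)\in\mathbf{\Gamma}$, $J(\underline\gamma)=\limsup_{N\to\infty}\frac1N\mathbb{E}^{\underline\gamma}\big[\sum_{i=1}^N c(\omega_0,u^i,\frac1N\sum_{p=1}^N u^p)\big]$. A policy $\underline\gamma^*\in\mathbf{\Gamma}$ is (globally, team) optimal for $(\mathcal{P}_\infty)$ if $J(\underline\gamma^* )=\inf_{\underline\gamma\in\mathbf{\Gamma}}J(\underline\gamma)$. Here $\mathbb{E}^{\underline\gamma}[\cdot]$ means that $u^i=\gamma^i(v^i)$ is substituted for all $i$. *)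

(* Defs.v *)
From HB Require Import structures.
From mathcomp Require Import all_boot all_order all_algebra.
From mathcomp Require Import all_classical all_reals all_analysis.

Set Implicit Arguments.
Unset Strict Implicit.
Unset Printing Implicit Defensive.

Import Order.TTheory GRing.Theory Num.Theory.
Import numFieldNormedType.Exports.

Local Open Scope classical_set_scope.
Local Open Scope ring_scope.

(* MathComp-Analysis has no measurable structure on matrices: equip them, hence
   'rV[R]_n, with the Borel sigma-algebra of their (product) topology. *)
Section borel_matrix.
Context {R : realType} {m n : nat}.

HB.instance Definition _ := Measurable.copy 'M[R]_(m, n)
  (g_sigma_algebraType [set A : set 'M[R]_(m, n) | open A]).

End borel_matrix.

Section mean_field_team.
Context {R : realType} {m n : nat}.

Definition policy := {mfun 'rV[R]_m >-> 'rV[R]_n}.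

Context {d d0 : measure_display} {Omega : measurableType d}
  {Omega0 : measurableType d0} (P : probability Omega R)
  (omega0 : {RV P >-> Omega0}) (v : nat -> {RV P >-> 'rV[R]_m})
  (c : Omega0 * 'rV[R]_n * 'rV[R]_n -> R).

Definition action (i : nat) (g : policy) (w : Omega) : 'rV[R]_n := g (v i w).

(* Decision makers are numbered from 0.  The value at N = 0 is junk; it is
   irrelevant to the limits superior below. *)
Definition team_cost (N : nat) (g : 'I_N -> policy) : \bar R :=
  ((N%:R^-1)%:E * 'E_P[fun w => (\sum_(i < N)
     c (omega0 w, action i (g i) w,
        N%:R^-1 *: \sum_(p < N) action p (g p) w))%R])%E.

Definition team_optimal (N : nat) (g : 'I_N -> policy) : Prop :=
  team_cost g = ereal_inf [set team_cost h | h in [set: 'I_N -> policy]].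

Definition limit_cost (g : nat -> policy) : \bar R :=
  limn_esup (fun N => team_cost (fun i : 'I_N => g i)).

Definition limit_optimal (g : nat -> policy) : Prop :=
  limit_cost g = ereal_inf [set limit_cost h | h in [set: nat -> policy]].

End mean_field_team.

Arguments policy : clear implicits.

(* Main.v *)
Require Import Defs.
From HB Require Import structures.
From mathcomp Require Import all_boot all_order all_algebra.
From mathcomp Require Import all_classical all_reals all_analysis.
Import Order.TTheory GRing.Theory Num.Theory.
Import numFieldNormedType.Exports.
Local Open Scope classical_set_scope.
Local Open Scope ring_scope.

(** The optimal costs of the finite problems bound the cost of every infinite
    policy from below.  If [h] is any sequence of policies, its first [N] components are
    admissible for the problem with [N] decision makers, so that the optimal
    [gN N] costs at most as much as they do.  Both costs being indexed by [N],
    monotonicity of the limit superior ([le_limf_esup]) gives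
    [limsup_N J_N(gN N) <= J(h)] ([limit_cost_ge_optimal]).  The hypothesis
    [J(g) <= limsup_N J_N(gN N)] then makes [J(g)] a lower bound of all the
    costs [J(h)]; being one of them, it is their infimum. *)

(** An eventual inequality is enough because the limit superior is an infimum
    over the members of the filter: each of them may be intersected with the
    set on which the inequality holds. *)
Lemma le_limf_esup {R : realType} {T : choiceType} {X : filteredType T}
    (f h : X -> \bar R) (F : set_system X) {FF : Filter F} :
  (\forall x \near F, (f x <= h x)%E) -> (limf_esup f F <= limf_esup h F)%E.
Proof.
move=> fh; apply: le_ereal_inf_tmp => _ [V FV <-].
apply: ge_ereal_inf.
exists (ereal_sup (f @` (V `&` [set x | (f x <= h x)%E]))).
  by exists (V `&` [set x | (f x <= h x)%E]) => //; exact: filterI.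
apply: ge_ereal_sup => _ [x [Vx fhx] <-].
by apply: le_ereal_sup_tmp; exists (h x) => //; exists x.
Qed.

Section finite_and_infinite_teams.
Context {R : realType} {m n : nat} {d d0 : measure_display}
  {Omega : measurableType d} {Omega0 : measurableType d0}
  {P : probability Omega R} (omega0 : {RV P >-> Omega0})
  (v : nat -> {RV P >-> 'rV[R]_m}) (c : Omega0 * 'rV[R]_n * 'rV[R]_n -> R).

Lemma team_optimal_le {N : nat} (g h : 'I_N -> policy R m n) :
  team_optimal omega0 v c g ->
  (team_cost omega0 v c g <= team_cost omega0 v c h)%E.
Proof. by move=> ->; apply: ereal_inf_lbound; exists h. Qed.

(** The [N]-th terms compare as soon as [0 < N], by optimality of [gN N] against
    the first [N] components of [h]; this is eventually the case. *)
Lemma limit_cost_ge_optimal (gN : forall N : nat, 'I_N -> policy R m n) :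
  (forall N : nat, (0 < N)%N -> team_optimal omega0 v c (gN N)) ->
  forall h : nat -> policy R m n,
  (limn_esup (fun N => team_cost omega0 v c (gN N))
    <= limit_cost omega0 v c h)%E.
Proof.
move=> gN_optimal h; apply: le_limf_esup.
near=> N; apply/team_optimal_le/gN_optimal.
by near: N; exact: nbhs_infty_gt.
Unshelve. all: by end_near. Qed.

End finite_and_infinite_teams.

Theorem theorem5 (R : realType) (n m : nat) (n_gt0 : (0 < n)%N)
    (m_gt0 : (0 < m)%N) (d d0 : measure_display) (Omega : measurableType d)
    (Omega0 : measurableType d0) (P : probability Omega R)
    (omega0 : {RV P >-> Omega0}) (v : nat -> {RV P >-> 'rV[R]_m})
    (c : {mfun (Omega0 * 'rV[R]_n * 'rV[R]_n)%type >-> R})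
    (c_ge0 : forall x, 0 <= c x)
    (gN : forall N : nat, 'I_N -> policy R m n)
    (gN_optimal : forall N : nat, (0 < N)%N -> team_optimal omega0 v c (gN N))
    (g : nat -> policy R m n)
    (g_fin : (limit_cost omega0 v c g < +oo)%E)
    (g_le : (limn_esup (fun N => team_cost omega0 v c (gN N))
             >= limit_cost omega0 v c g)%E) :
  limit_optimal omega0 v c g.
Proof.
apply/eqP; rewrite eq_le; apply/andP; split.
  apply: le_ereal_inf_tmp => _ [h _ <-].
  exact: le_trans g_le (limit_cost_ge_optimal _ _ _ _ gN_optimal h).
by apply: ereal_inf_lbound; exists g.
Qed.
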